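(* Consider the finite-horizon MDP, the functions $f_\theta$, and the augmented MDP $\tilde{\mathcal M}_\theta$ described in the context. For any $\theta\in\Theta$ and any randomized Markovian policy $\pi\in\Pi_{\mathrm{MR}}(\tilde{\mathcal M}_\theta)$, define $$\tilde V^{\pi,\theta}_t(s,x)=\mathbb E^\pi_{\tilde{\mathbb P}}\Big[\sum_{h=t}^T\tilde c^\theta_h(S_h,X_h,A_h)\,\Big|\,S_t=s,X_t=x\Big].$$ Then $\tilde V^{\pi,\theta}_T(s,x)=\sum_{a\in\mathcal A_T}\pi_T(a|s,x)\tilde c^\theta_T(s,x,a)$ for all $(s,x)\in\mathcal S_T\times\mathcal X_T$, and for all $0\le t\le T-1$ and $(s,x)\in\mathcal S_t\times\mathcal X_t$, $$\tilde V^{\pi,\theta}_t(s,x)=\mathbb E_{a\sim\pi_t(\cdot|s,x)}\Big[\tilde c^\theta_t(s,x,a)+\sum_{s'\in\mathcal S_{t+1}}\mathbb P_t(s'|s,a)\,\tilde V^{\pi,\theta}_{t+1}\big(s',x+c_t(s,a)\big)\Big].$$ In addition, for $s\in\mathcal S_0$ let $\theta_\pi\in\operatorname{Argmin}_{\theta\in\Theta}\{\tilde V^{\pi,\theta}_0(s,0)+f_\theta(0)\}$. Then for any $\pi\in\Pi_{\mathrm{MR}}(\tilde{\mathcal M}_\theta)$, $$\mathcal R^\pi(s)=\tilde V^{\pi,\theta_\pi}_0(s,0)+f_{\theta_\pi}(0).$$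
   Context: MDP: $T$ is a positive integer; for $0\le t\le T$, $\mathcal S_t$ is a finite state space, $\mathcal A_t$ a finite action space, and $c_t:\mathcal S_t\times\mathcal A_t\to[0,1]$ a cost function; for $0\le t\le T-1$, $\mathbb P_t(\cdot|s,a)$ is a probability distribution on $\mathcal S_{t+1}$ for each $(s,a)$. $\Theta\subseteq\mathbb R^{d_\Theta}$ is a parameter set and $f_\theta:\mathbb R\to\mathbb R$ for $\theta\in\Theta$. Augmented MDP $\tilde{\mathcal M}_\theta$: state space $\mathcal S_t\times\mathcal X_t$ with $\mathcal X_t=[0,t]$, action space $\mathcal A_t$, cost $\tilde c^\theta_t(s,x,a)=f_\theta(x+c_t(s,a))-f_\theta(x)$, and transition kernel $\tilde{\mathbb P}_t(s',x'|s,x,a)=\mathbb P_t(s'|s,a)\mathbf 1\{x'=x+c_t(s,a)\}$. $\Pi_{\mathrm{MR}}(\tilde{\mathcal M}_\theta)$ is the set of randomized Markovian policies of $\tilde{\mathcal M}_\theta$: at stage $t$, $\pi_t(\cdot|s,x)$ is a probability distribution on $\mathcal A_t$ (this set does not depend on $\theta$). $\mathbb E^\pi_{\tilde{\mathbb P}}$ is the expectation for the augmented process under $\pi$; conditioning on $(S_t,X_t)=(s,x)$ means starting the process at stage $t$ from $(s,x)$. Risk: $\mathcal R^\pi(s)=\min_{\theta\in\Theta}\mathbb E^\pi[f_\theta(\sum_{t=0}^Tc_t(S_t,A_t))\mid S_0=s]$, where $A_t\sim\pi_t(\cdot|S_t,X_t)$, $X_0=0$, $X_{t+1}=X_t+c_t(S_t,A_t)$,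 $S_{t+1}\sim\mathbb P_t(\cdot|S_t,A_t)$. *)

(* Defs.v *)
From HB Require Import structures.
From mathcomp Require Import all_boot all_order all_algebra.
From mathcomp Require Import boolp classical_sets functions cardinality fsbigop.
From mathcomp Require Import reals.

Set Implicit Arguments.
Unset Strict Implicit.
Unset Printing Implicit Defensive.

Import Order.TTheory GRing.Theory Num.Theory.

Local Open Scope classical_set_scope.
Local Open Scope ring_scope.

Definition is_dist (R : realType) (T : finType) (p : T -> R) : Prop :=
  (forall x, 0 <= p x) /\ \sum_(x : T) p x = 1.

Definition argmin (R : realType) (I : Type) (D : set I) (g : I -> R) : set I :=
  [set i | D i /\ forall j, D j -> g i <= g j].

(* The default value 0 is returned only when [A] has no least element. *)
Definition set_min (R : realType) (A : set R) : R :=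
  xget 0 [set m | A m /\ forall y, A y -> m <= y].

(* Stages are natural numbers; the data at stages beyond the horizon (and the
   transitions out of stage [horizon]) are unconstrained and never used. *)
Record mdp (R : realType) := Mdp {
  horizon : nat;
  horizon_gt0 : (0 < horizon)%N;
  state : nat -> finType;
  action : nat -> finType;
  cost : forall t, state t -> action t -> R;
  cost_range : forall t s a, (t <= horizon)%N -> 0 <= @cost t s a <= 1;
  trans : forall t, state t -> action t -> state t.+1 -> R;
  trans_dist : forall t s a, (t < horizon)%N -> is_dist (@trans t s a)
}.

Definition level (R : realType) (t : nat) := {x : R | 0 <= x <= t%:R}.

Lemma level0_subproof (R : realType) (t : nat) : 0 <= (0 : R) <= t%:R.
Proof. by rewrite lexx ler0n. Qed.

Definition level0 (R : realType) (t : nat) : level R t :=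
  exist _ 0 (level0_subproof R t).

Section AugmentedProcess.
Context {R : realType} (M : mdp R).

(* [insubd] is used only to make the function total: see [val_next_level]. *)
Definition next_level t (s : state M t) (x : level R t) (a : action M t) :
  level R t.+1 := insubd (level0 R t.+1) (val x + cost s a).

Lemma val_next_level t (s : state M t) (x : level R t) (a : action M t) :
  (t <= horizon M)%N -> val (next_level s x a) = val x + cost s a.
Proof.
move=> tT; rewrite /next_level val_insubd.
have /andP[c0 c1] := cost_range s a tT.
have /andP[x0 xt] := valP x.
by rewrite addr_ge0 //= -natr1 lerD.
Qed.

Record MR_policy := MRPolicy {
  pol : forall t, state M t -> level R t -> action M t -> R;
  pol_dist : forall t s x, (t <= horizon M)%N -> is_dist (@pol t s x)
}.

Definition aug_cost (g : R -> R) t (s : state M t) (x : level R t)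
  (a : action M t) : R := g (val x + cost s a) - g (val x).

Definition aug_trans t (s : state M t) (x : level R t) (a : action M t)
    (z : state M t.+1 * level R t.+1) : R :=
  trans s a z.1 * (val z.2 == val x + cost s a)%:R.

(* Trajectories (S_h, X_h, A_h) for the [n.+1] stages h = t, ..., t + n. *)
Fixpoint aug_traj (t n : nat) {struct n} : choiceType :=
  if n is m.+1
  then (state M t * level R t * action M t * aug_traj t.+1 m)%type
  else (state M t * level R t * action M t)%type.

(* Probability mass function of the trajectory under [pi], when (S_t, X_t) has
   probability mass function [mu]. *)
Fixpoint aug_law (pi : MR_policy) (t n : nat) {struct n} :
    (state M t * level R t -> R) -> aug_traj t n -> R :=
  match n return (state M t * level R t -> R) -> aug_traj t n -> R with
  | 0 => fun mu w => let: (s, x, a) := w in mu (s, x) * pol pi s x a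
  | m.+1 => fun mu w => let: (s, x, a, w') := w in
      mu (s, x) * pol pi s x a * aug_law pi (aug_trans s x a) w'
  end.

Fixpoint aug_sum (g : forall t, state M t -> level R t -> action M t -> R)
    (t n : nat) {struct n} : aug_traj t n -> R :=
  match n return aug_traj t n -> R with
  | 0 => fun w => let: (s, x, a) := w in g t s x a
  | m.+1 => fun w => let: (s, x, a, w') := w in g t s x a + aug_sum g w'
  end.

(* Although levels are real numbers, only finitely many trajectories have
   nonzero probability, so the finitely supported sum is the expectation. *)
Definition aug_expect (pi : MR_policy) (t n : nat) (s : state M t)
    (x : level R t) (F : aug_traj t n -> R) : R :=
  \sum_(w \in [set: aug_traj t n])
    aug_law pi (fun z => (z == (s, x))%:R) w * F w.

Definition V (pi : MR_policy) (g : R -> R) (t : nat) (s : state M t)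
    (x : level R t) : R :=
  aug_expect pi s x (@aug_sum (aug_cost g) t (horizon M - t)).

(* Trajectories (S_h, A_h) of the original process, h = t, ..., t + n. *)
Fixpoint traj (t n : nat) {struct n} : finType :=
  if n is m.+1 then (state M t * action M t * traj t.+1 m)%type
  else (state M t * action M t)%type.

(* Here X_t = [x] and S_t has probability mass function [mu]; the later X_h are
   computed along the trajectory. *)
Fixpoint law (pi : MR_policy) (t n : nat) {struct n} :
    (state M t -> R) -> level R t -> traj t n -> R :=
  match n return (state M t -> R) -> level R t -> traj t n -> R with
  | 0 => fun mu x w => let: (s, a) := w in mu s * pol pi s x a
  | m.+1 => fun mu x w => let: (s, a, w') := w in
      mu s * pol pi s x a * law pi (trans s a) (next_level s x a) w'
  end.

Fixpoint total_cost (t n : nat) {struct n} : traj t n -> R :=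
  match n return traj t n -> R with
  | 0 => fun w => let: (s, a) := w in cost s a
  | m.+1 => fun w => let: (s, a, w') := w in cost s a + total_cost w'
  end.

Definition expect (pi : MR_policy) (s : state M 0)
    (F : traj 0 (horizon M) -> R) : R :=
  \sum_(w : traj 0 (horizon M))
    law pi (fun s' => (s' == s)%:R) (level0 R 0) w * F w.

Definition risk (I : Type) (Theta : set I) (f : I -> R -> R) (pi : MR_policy)
    (s : state M 0) : R :=
  set_min [set expect pi s (fun w => f theta (total_cost w)) | theta in Theta].

End AugmentedProcess.

(* Main.v *)
(* Along a trajectory of positive probability the levels X_h are determined by
   X_t and the state-action pairs, so expectations for the augmented process are
   finite sums over trajectories of the original process.  Conditioning on the
   first stage gives the recursion.  The augmented costs telescope, so V_0(s, 0)
   is the expectation of f(total cost) - f(0); hence V_0 + f(0) is the objective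
   minimized in the risk. *)
Require Import Defs.
From HB Require Import structures.
From mathcomp Require Import all_boot all_order all_algebra.
From mathcomp Require Import boolp classical_sets functions cardinality fsbigop.
From mathcomp Require Import reals.

Set Implicit Arguments.
Unset Strict Implicit.
Unset Printing Implicit Defensive.

Import Order.TTheory GRing.Theory Num.Theory.

Local Open Scope classical_set_scope.
Local Open Scope ring_scope.

(** A minimizer makes the set of least elements nonempty, so [xget] avoids its default; antisymmetry
    of the order leaves only one candidate. *)
Lemma set_min_argmin (R : realType) (I : Type) (D : set I) (g : I -> R) (i : I) :
  argmin D g i -> set_min [set g j | j in D] = g i.
Proof.
move=> [Di gi_min]; rewrite /set_min; apply: xget_subset1.
  by split; [exists i | move=> _ [j Dj <-]; exact: gi_min].
move=> a b [Aa a_min] [Ab b_min].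
by apply/eqP; rewrite eq_le a_min // b_min.
Qed.

Lemma sum_delta (R : pzRingType) (T : finType) (i : T) (g : T -> R) :
  \sum_j (j == i)%:R * g j = g i.
Proof.
rewrite (bigD1 i) //= eqxx mul1r big1 ?addr0 // => j /negbTE->.
by rewrite mul0r.
Qed.

Section Trajectories.
Context {R : realType} (M : mdp R).

(** Its range carries all the mass of the augmented law started at level [x]. *)
Fixpoint add_levels (t n : nat) {struct n} :
    level R t -> traj M t n -> aug_traj M t n :=
  match n return level R t -> traj M t n -> aug_traj M t n with
  | 0 => fun x w => let: (s, a) := w in (s, x, a)
  | m.+1 => fun x w => let: (s, a, w') := w in
      (s, x, a, add_levels (next_level s x a) w')
  end.

Fixpoint drop_levels (t n : nat) {struct n} : aug_traj M t n -> traj M t n :=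
  match n return aug_traj M t n -> traj M t n with
  | 0 => fun w => let: (s, _, a) := w in (s, a)
  | m.+1 => fun w => let: (s, _, a, w') := w in (s, a, drop_levels w')
  end.

Lemma add_levelsK (t n : nat) (x : level R t) :
  cancel (@add_levels t n x) (@drop_levels t n).
Proof.
elim: n t x => [|n IHn] t x /=; first by case.
by move=> [[s a] w]; rewrite IHn.
Qed.

(** A mass function on states times a point mass on levels is the form of initial law over which
    [aug_lawE] inducts. *)
Lemma aug_transE (t : nat) (s : state M t) (x : level R t) (a : action M t) :
  (t <= horizon M)%N ->
  aug_trans s x a = fun z => trans s a z.1 * (z.2 == next_level s x a)%:R.
Proof.
by move=> tT; apply: funext => z; rewrite /aug_trans -val_next_level // val_eqE.
Qed.

(** The costs telescope; the horizon bound ensures that [next_level] truly adds the cost. *)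
Lemma aug_sum_add_levels (g : R -> R) (t n : nat) (x : level R t)
    (w : traj M t n) :
  (t + n <= horizon M)%N ->
  aug_sum (aug_cost g) (add_levels x w) = g (val x + total_cost w) - g (val x).
Proof.
elim: n t x w => [|n IHn] t x /=; first by case.
move=> [[s a] w] tnT; rewrite IHn ?addSnnS // val_next_level; last first.
  exact: leq_trans (leq_addr _ _) tnT.
by rewrite /aug_cost addrC addrA subrK addrA.
Qed.

Variable pi : MR_policy M.

(** One wrong level kills the factor of its stage; with all levels right, both laws multiply the
    same factors. *)
Lemma aug_lawE (t n : nat) (mu : state M t -> R) (x : level R t)
    (w : aug_traj M t n) :
  (t + n <= horizon M)%N ->
  aug_law pi (fun z => mu z.1 * (z.2 == x)%:R) w =
  law pi mu x (drop_levels w) * (w == add_levels x (drop_levels w))%:R.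
Proof.
elim: n t mu x w => [|n IHn] t mu x /=.
  move=> [[s y] a] _; rewrite !xpair_eqE !eqxx /= andbT.
  by case: eqP => [->|_]; rewrite !(mulr0, mulr1, mul0r).
move=> [[[s y] a] w] tnT; rewrite !xpair_eqE !eqxx /= andbT.
case: eqP => [->|_] /=; last by rewrite !(mulr0, mul0r).
rewrite aug_transE; last exact: leq_trans (leq_addr _ _) tnT.
by rewrite IHn ?addSnnS // !mulr1 mulrA.
Qed.

Lemma aug_expectE (t n : nat) (s : state M t) (x : level R t)
    (F : aug_traj M t n -> R) :
  (t + n <= horizon M)%N ->
  aug_expect pi s x F =
  \sum_w law pi (fun s' => (s' == s)%:R) x w * F (add_levels x w).
Proof.
move=> tnT; rewrite /aug_expect.
have -> : (fun z => (z == (s, x))%:R) =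
    (fun z : state M t * level R t => (z.1 == s)%:R * (z.2 == x)%:R : R).
  by apply: funext => -[s' y]; rewrite -natrM mulnb xpair_eqE.
(* The law vanishes off the range of [add_levels]; injectivity then reindexes the sum by the finite
   type [traj M t n]. *)
rewrite -(fsbig_widen (range (@add_levels t n x))) //=; last first.
  move=> w [_ /= w_out]; rewrite (aug_lawE (fun s' => (s' == s)%:R)) //.
  case: eqP => [w_in|_]; last by rewrite mulr0 mul0r.
  by case: w_out; exists (drop_levels w).
rewrite fsbig_image; last by move=> w w' _ _; exact: (can_inj (@add_levelsK t n x)).
rewrite (fsbigE (index_enum (traj M t n))) //; first last.
- by move=> w _; rewrite mem_index_enum.
- exact: index_enum_uniq.
apply: eq_big => [w|w _]; first exact: mem_set.
by rewrite (aug_lawE (fun s' => (s' == s)%:R)) // add_levelsK eqxx mulr1.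
Qed.

Lemma law_expect0 (t : nat) (mu : state M t -> R) (x : level R t)
    (F : traj M t 0 -> R) :
  \sum_w law pi mu x w * F w =
  \sum_s mu s * \sum_a pol pi s x a * F (s, a).
Proof.
rewrite (eq_bigr (fun s => \sum_a mu s * pol pi s x a * F (s, a))).
  by rewrite pair_bigA; apply: eq_bigr => -[].
by move=> s _; rewrite mulr_sumr; apply: eq_bigr => a _; rewrite mulrA.
Qed.

(** Markov property: given the first stage, the tail follows the law restarted from [trans s a]. *)
Lemma law_expectS (t n : nat) (mu : state M t -> R) (x : level R t)
    (F : traj M t n.+1 -> R) :
  \sum_w law pi mu x w * F w =
  \sum_s mu s * \sum_a pol pi s x a *
    \sum_w law pi (trans s a) (next_level s x a) w * F (s, a, w).
Proof.
rewrite (eq_bigr (fun s => \sum_a \sum_w mu s * pol pi s x a *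
    law pi (trans s a) (next_level s x a) w * F (s, a, w))).
  by rewrite !pair_bigA; apply: eq_bigr => -[[]].
move=> s _; rewrite mulr_sumr; apply: eq_bigr => a _.
by rewrite mulrA mulr_sumr; apply: eq_bigr => w _; rewrite mulrA.
Qed.

(** The law is linear in [mu], which enters only as the first factor. This passes from the start
    [trans s a] to the point masses used by [V]. *)
Lemma law_expect_mix (t n : nat) (mu : state M t -> R) (x : level R t)
    (F : traj M t n -> R) :
  \sum_w law pi mu x w * F w =
  \sum_s mu s * \sum_w law pi (fun s' => (s' == s)%:R) x w * F w.
Proof.
case: n F => [|n] F.
  by rewrite law_expect0; under [RHS]eq_bigr do rewrite law_expect0 sum_delta.
by rewrite law_expectS; under [RHS]eq_bigr do rewrite law_expectS sum_delta.
Qed.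

Lemma law_total (t n : nat) (mu : state M t -> R) (x : level R t) :
  (t + n <= horizon M)%N ->
  \sum_(w : traj M t n) law pi mu x w = \sum_s mu s.
Proof.
(* The total mass is read as the expectation of the constant 1, so that first-stage conditioning
   applies. *)
move=> tnT; under eq_bigr do rewrite -[law _ _ _ _]mulr1.
elim: n t mu x tnT => [|n IHn] t mu x tnT.
  rewrite law_expect0; apply: eq_bigr => s _.
  under eq_bigr do rewrite mulr1.
  by rewrite (pol_dist _ _ _ _).2 ?mulr1 // -[t]addn0.
have tT : (t < horizon M)%N by rewrite (leq_trans _ tnT) // -addSnnS leq_addr.
rewrite law_expectS; apply: eq_bigr => s _.
under eq_bigr do rewrite IHn ?addSnnS // (trans_dist _ _ tT).2 mulr1.
by rewrite (pol_dist _ _ _ _).2 ?mulr1 // ltnW.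
Qed.

Lemma VE (g : R -> R) (t : nat) (s : state M t) (x : level R t) :
  (t <= horizon M)%N ->
  V pi g s x = \sum_w law pi (fun s' => (s' == s)%:R) x w *
    aug_sum (aug_cost g) (@add_levels t (horizon M - t) x w).
Proof. by move=> tT; rewrite /V aug_expectE ?subnKC. Qed.

Lemma V_horizon (g : R -> R) (s : state M (horizon M))
    (x : level R (horizon M)) :
  V pi g s x = \sum_a pol pi s x a * aug_cost g s x a.
Proof. by rewrite VE // subnn law_expect0 sum_delta. Qed.

Lemma V_rec (g : R -> R) (t : nat) (s : state M t) (x : level R t) :
  (t < horizon M)%N ->
  V pi g s x = \sum_a pol pi s x a * (aug_cost g s x a +
    \sum_s' trans s a s' * V pi g s' (next_level s x a)).
Proof.
(* Writing [horizon M - t] as a successor splits the first stage off the trajectory type. *)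
move=> tT; rewrite VE ?(ltnW tT) // -subnSK // law_expectS sum_delta.
apply: eq_bigr => a _; congr (_ * _).
under eq_bigr do rewrite /= mulrDr.
(* The immediate cost is constant along the tail, whose total mass is that of [trans s a], namely
   1. *)
rewrite big_split /= -mulr_suml law_total ?addSnnS ?subnSK ?subnKC ?(ltnW tT) //.
rewrite (trans_dist _ _ tT).2 mul1r law_expect_mix; congr (_ + _).
by apply: eq_bigr => s' _; rewrite VE.
Qed.

Lemma V0_expect (g : R -> R) (s : state M 0) :
  V pi g s (level0 R 0) + g 0 = expect pi s (fun w => g (total_cost w)).
Proof.
rewrite VE // subn0.
under eq_bigr do rewrite aug_sum_add_levels //= add0r mulrBr.
rewrite sumrB -mulr_suml law_total //.
have -> : \sum_s' (s' == s)%:R = 1 :> R.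
  by under eq_bigr do rewrite -[_%:R]mulr1; rewrite sum_delta.
by rewrite mul1r subrK.
Qed.

End Trajectories.

Theorem theorem2p2 (R : realType) (M : mdp R) (d : nat)
    (Theta : set 'rV[R]_d) (f : 'rV[R]_d -> R -> R) :
  (forall (theta : 'rV[R]_d) (pi : MR_policy M), Theta theta ->
    (forall (s : state M (horizon M)) (x : level R (horizon M)),
      V pi (f theta) s x
      = \sum_(a : action M (horizon M))
          pol pi s x a * aug_cost (f theta) s x a)
    /\
    (forall t : nat, (t < horizon M)%N ->
      forall (s : state M t) (x : level R t),
      V pi (f theta) s x
      = \sum_(a : action M t) pol pi s x a *
          (aug_cost (f theta) s x a
           + \sum_(s' : state M t.+1)
               trans s a s' * V pi (f theta) s' (next_level s x a))))
  /\
  (forall (pi : MR_policy M) (s : state M 0) (theta_pi : 'rV[R]_d),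
    argmin Theta
      (fun theta => V pi (f theta) s (level0 R 0) + f theta 0) theta_pi ->
    risk Theta f pi s
    = V pi (f theta_pi) s (level0 R 0) + f theta_pi 0).
Proof.
split=> [theta pi _|pi s theta_pi].
  by split=> [s x|t tT s x]; [exact: V_horizon | exact: V_rec].
(* The function minimized by [theta_pi] becomes the one whose minimum defines [risk]. *)
under eq_fun do rewrite V0_expect.
by move=> theta_min; rewrite V0_expect; exact: set_min_argmin theta_min.
Qed.
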